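(* The critical probability $\dot{p}_c(\mathbb{Z}^3)$ of Bernoulli site percolation on the cubic lattice $\mathbb{Z}^3$ satisfies $$\dot{p}_c(\mathbb{Z}^3)>0.2522.$$
   Context: $\mathbb{Z}^3$ denotes the cubic lattice, i.e. the graph with vertex set $\mathbb{Z}^3$ in which two vertices are adjacent when they are at Euclidean distance $1$. In Bernoulli site percolation with parameter $p\in[0,1]$, each vertex is independently declared occupied with probability $p$ and vacant otherwise; $\dot{p}_c(\mathbb{Z}^3)$ is the supremum of those $p$ for which, almost surely, the subgraph induced by the occupied vertices has no infinite component. *)

(* Defs.v *)
From HB Require Import structures.
From mathcomp Require Import all_boot all_order all_algebra.
From mathcomp Require Import all_classical all_reals all_analysis.
From mathcomp Require Import measurable_realfun.

Set Implicit Arguments.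
Unset Strict Implicit.
Unset Printing Implicit Defensive.

Import Order.TTheory GRing.Theory Num.Theory.
Import numFieldNormedType.Exports.

Local Open Scope classical_set_scope.
Local Open Scope ring_scope.

Notation site := 'rV[int]_3.

(* The squared distance is an integer, so distance 1 means squared distance 1. *)
Definition adjacent (x y : site) : bool :=
  \sum_(i < 3) (x ord0 i - y ord0 i) ^+ 2 == 1.

(* [w x = true] means that [x] is occupied. *)
Definition configuration := site -> bool.

Definition occupied (x : site) : set configuration := [set w | w x].

(* Configurations with the product (cylinder) sigma-algebra; the events
   [occupied x] generate it. *)
Notation config_space := (g_sigma_algebraType (range occupied)).

Definition mutually_independent d (T : measurableType d) (R : realType)
    (P : probability T R) (I : eqType) (E : I -> set T) : Prop :=
  forall s : seq I, uniq s ->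
    P (\bigcap_(i in [set` s]) E i) = (\prod_(i <- s) P (E i))%E.

Definition site_percolation (R : realType) (p : R)
    (P : probability config_space R) : Prop :=
  mutually_independent P occupied /\ forall x, P (occupied x) = p%:E.

Definition occupied_edge (w : configuration) : rel site :=
  fun x y => [&& w x, w y & adjacent x y].

Definition component (w : configuration) (x : site) : set site :=
  [set y | exists2 s : seq site, path (occupied_edge w) x s & y = last x s].

Definition has_infinite_component (w : configuration) : Prop :=
  exists2 x : site, w x & infinite_set (component w x).

(* For [p] in [0, 1] there is exactly one [P] with [site_percolation p P]:
   existence is [site_percolation_exists] below, and uniqueness holds because
   finite intersections of events [occupied x] form a generating pi-system. *)
Definition site_pc (R : realType) : R :=
  sup [set p : R | 0 <= p <= 1 /\
    forall P : probability config_space R, site_percolation p P ->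
      {ae P, forall w, ~ has_infinite_component w}].

(* A Bernoulli site percolation is built from one uniform point x of [0, 1[: its
   iterates under the map sending [0, p[ and [p, 1[ affinely onto [0, 1[ fall
   below p independently, each with probability p. *)
Definition bit_shift (R : realType) (p x : R) : R :=
  if x < p then x / p else (x - p) / (1 - p).

Definition has_bits (R : realType) (p : R) : seq bool -> set R :=
  fix F w := if w is b :: w' then
    [set x | 0 <= x < 1 /\ (x < p) = b /\ F w' (bit_shift p x)]
  else [set x | 0 <= x < 1].

Definition bits_prob (R : realType) (p : R) (w : seq bool) : R :=
  \prod_(b <- w) (if b then p else 1 - p).

Lemma bits_prob_ge0 (R : realType) (p : R) w :
  0 <= p <= 1 -> 0 <= bits_prob p w.
Proof.
move=> /andP[p0 p1]; rewrite /bits_prob; elim/big_ind: _ => //.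
  exact: mulr_ge0.
by move=> [] _ //; rewrite subr_ge0.
Qed.

Lemma has_bitsE (R : realType) (p : R) w : 0 <= p <= 1 ->
  exists a, [/\ 0 <= a, a + bits_prob p w <= 1 &
    has_bits p w = [set x | a <= x < a + bits_prob p w]].
Proof.
move=> p01; have /andP[p0 p1] := p01.
elim: w => [|b w [a [a0 a1 aE]]].
  by exists 0; rewrite /bits_prob big_nil add0r; split.
have l0 := bits_prob_ge0 w p01.
have -> : bits_prob p (b :: w) = (if b then p else 1 - p) * bits_prob p w.
  by rewrite /bits_prob big_cons.
case: b.
  exists (p * a); rewrite -mulrDr; split.
  - exact: mulr_ge0.
  - by rewrite mulr_ile1// addr_ge0.
  - apply/seteqP; split => x /=; rewrite aE /= /bit_shift.
      move=> [/andP[x0 x1] [xp]]; rewrite xp.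
      have pgt0 : 0 < p by exact: le_lt_trans xp.
      by rewrite ler_pdivlMr// ltr_pdivrMr// mulrC (mulrC _ p).
    move=> /andP[h1 h2].
    have xp : x < p by rewrite (lt_le_trans h2)// ler_piMr.
    have x0 : 0 <= x by apply: le_trans h1; exact: mulr_ge0.
    have pgt0 : 0 < p by exact: le_lt_trans xp.
    rewrite x0 (lt_le_trans xp p1) xp; split=> //; split=> //.
    by rewrite ler_pdivlMr// ltr_pdivrMr// mulrC h1 mulrC.
have q0 : 0 <= 1 - p by rewrite subr_ge0.
exists (p + (1 - p) * a); rewrite -addrA -mulrDr; split.
- by rewrite addr_ge0// mulr_ge0.
- by rewrite -lerBrDl ler_piMr.
- apply/seteqP; split => x /=; rewrite aE /= /bit_shift.
    move=> [/andP[x0 x1] [xp]]; rewrite xp.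
    have px : p <= x by rewrite leNgt xp.
    have q : 0 < 1 - p by rewrite subr_gt0 (le_lt_trans px).
    by rewrite ler_pdivlMr// ltr_pdivrMr// lerBrDl ltrBlDl mulrC (mulrC _ (1 - p)).
  move=> /andP[h1 h2].
  have px : p <= x by apply: le_trans h1; rewrite lerDl mulr_ge0.
  have x1 : x < 1 by rewrite (lt_le_trans h2)// -lerBrDl ler_piMr.
  have q : 0 < 1 - p by rewrite subr_gt0 (le_lt_trans px).
  rewrite (le_trans p0 px) x1 ltNge px; split=> //; split=> //=.
  by rewrite ler_pdivlMr// ltr_pdivrMr// lerBrDl ltrBlDl mulrC h1 mulrC.
Qed.

Lemma measurable_bit_shift (R : realType) (p : R) :
  measurable_fun [set: measurableTypeR R]
    (bit_shift p : measurableTypeR R -> measurableTypeR R).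
Proof.
apply: measurable_fun_ifT.
- exact: measurable_fun_ltr.
- exact: measurable_funM.
- by apply: measurable_funM => //; exact: measurable_funB.
Qed.

Lemma measurable_bit (R : realType) (p : R) (n : nat) :
  measurable [set x : measurableTypeR R | iter n (bit_shift p) x < p].
Proof.
have mi : measurable_fun [set: measurableTypeR R]
    (iter n (bit_shift p) : measurableTypeR R -> measurableTypeR R).
  elim: n => [|n IH]; first exact: measurable_id.
  by apply: (measurableT_comp (measurable_bit_shift p)).
have -> : [set x : measurableTypeR R | iter n (bit_shift p) x < p] =
  [set: measurableTypeR R] `&` iter n (bit_shift p) @^-1` `]-oo, p[.
  by apply/seteqP; split => x /=; rewrite in_itv//= => -[].
exact: mi.
Qed.

Lemma has_bits_prob (R : realType) (p : R) w : 0 <= p <= 1 ->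
  measurable (has_bits p w : set (measurableTypeR R)) /\
  uniform_prob (@ltr01 R) (has_bits p w) = (bits_prob p w)%:E.
Proof.
move=> p01; have [a [a0 a1 ->]] := has_bitsE w p01.
have l0 := bits_prob_ge0 w p01.
have -> : [set x | a <= x < a + bits_prob p w] =
    ([set` `[a, a + bits_prob p w[] : set (measurableTypeR R)).
  by apply/seteqP; split => x /=; rewrite in_itv.
split; first exact: measurable_itv.
have sub : [set` `[a, a + bits_prob p w[] `<=` [set` `[0:R, 1]].
  move=> x /=; rewrite !in_itv/= => /andP[ax xa].
  by rewrite (le_trans a0 ax) (le_trans (ltW xa)).
rewrite /uniform_prob integral_uniform_pdf setIidl//.
rewrite (eq_integral (fun=> 1%:E)); last first.
  move=> x; rewrite inE => /sub /=; rewrite in_itv /= => x01.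
  by rewrite /uniform_pdf x01 subr0 invr1.
rewrite integral_cst//= mul1e lebesgue_measure_itv/= lte_fin ltrDl.
case: ltP => l; last first.
  by congr EFin; apply/eqP; rewrite eq_le l0 l.
by rewrite -EFinB addrAC subrr add0r.
Qed.

Definition matches (R : realType) (p : R) (t : seq bool) (x : R) : Prop :=
  forall n, nth false t n -> iter n (bit_shift p) x < p.

Definition has_bits_then (R : realType) (p : R) (t : seq bool) :
    seq bool -> set R :=
  fix F w := if w is b :: w' then
    [set x | 0 <= x < 1 /\ (x < p) = b /\ F w' (bit_shift p x)]
  else [set x | 0 <= x < 1 /\ matches p t x].

Lemma matches_cons (R : realType) (p : R) c t (x : R) :
  matches p (c :: t) x <-> (c -> x < p) /\ matches p t (bit_shift p x).
Proof.
split=> [h|[h1 h2] [|n] /= hn].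
- split=> [hc|n hn]; first exact: (h 0%N).
  by have := h n.+1 hn; rewrite iterSr.
- exact: h1.
- by have := h2 n hn; rewrite -iterSr.
Qed.

Lemma bit_shift01 (R : realType) (p x : R) : 0 <= p <= 1 -> 0 <= x < 1 ->
  0 <= bit_shift p x < 1.
Proof.
move=> p01 x01; have /andP[p0 p1] := p01; have /andP[x0 x1] := x01.
rewrite /bit_shift; case: ltP => xp.
  have pgt0 : 0 < p by exact: le_lt_trans xp.
  by rewrite divr_ge0// ltr_pdivrMr// mul1r.
have q : 0 < 1 - p by rewrite subr_gt0 (le_lt_trans xp).
by rewrite divr_ge0 ?subr_ge0// ltr_pdivrMr// mul1r ltrD2r.
Qed.

Lemma has_bits_then_cons (R : realType) (p : R) c t w : 0 <= p <= 1 ->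
  has_bits_then p (c :: t) w = has_bits_then p t (rcons w true) `|`
    (if c then set0 else has_bits_then p t (rcons w false)).
Proof.
move=> p01; elim: w => [|b w IH] /=.
  apply/seteqP; split => x /=.
    move=> [x01 /matches_cons[hc ht]]; have Tx := bit_shift01 p01 x01.
    case: (ltP x p) => xp; first by left.
    right; case: c hc => [/(_ isT)|_]; first by rewrite ltNge xp.
    by rewrite /= (ltNge x p) xp.
  move=> [[x01 [xp [_ ht]]]|]; first by split=> //; apply/matches_cons.
  case: c => //= -[x01 [xp [_ ht]]]; split=> //.
  by apply/matches_cons.
rewrite IH; case: c {IH}; apply/seteqP; split => x /=.
- by move=> [? [? [|//]]]; left.
- by move=> [[? [? ?]]|//]; split=> //; split=> //; left.
- by move=> [? [? []]]; [left|right].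
- by move=> [] [? [? ?]]; split=> //; split=> //; [left|right].
Qed.

Lemma has_bits_then_disj (R : realType) (p : R) t w :
  has_bits_then p t (rcons w true) `&` has_bits_then p t (rcons w false) = set0.
Proof.
elim: w => [|b w IH] /=; rewrite -subset0 => x /=.
  by move=> [[_ [-> _]] [_ [//]]].
by move=> [[_ [_ h1]] [_ [_ h2]]]; rewrite -[False]/(set0 (bit_shift p x)) -IH.
Qed.

Lemma has_bits_then_prob (R : realType) (p : R) t w : 0 <= p <= 1 ->
  measurable (has_bits_then p t w : set (measurableTypeR R)) /\
  uniform_prob (@ltr01 R) (has_bits_then p t w) =
    (bits_prob p w * p ^+ count id t)%:E.
Proof.
move=> p01; elim: t w => [|c t IH] w.
  have -> : has_bits_then p [::] w = has_bits p w.
    elim: w => [|b w /= ->//] /=.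
    by apply/seteqP; split => x //= => [[]//|h]; split=> // n; rewrite nth_nil.
  by rewrite expr0 mulr1; exact: has_bits_prob.
have [mt Pt] := IH (rcons w true); have [mf Pf] := IH (rcons w false).
have rc b : bits_prob p (rcons w b) = bits_prob p w * (if b then p else 1 - p).
  by rewrite /bits_prob -cats1 big_cat big_seq1.
rewrite has_bits_then_cons//; case: c => /=.
  by rewrite setU0 Pt rc exprS mulrA.
split; first exact: measurableU.
rewrite measureU//; last exact: has_bits_then_disj.
rewrite add0n; transitivity ((bits_prob p (rcons w true) * p ^+ count id t)%:E +
  (bits_prob p (rcons w false) * p ^+ count id t)%:E)%E; first by rewrite -Pt -Pf.
by rewrite -EFinD !rc -mulrDl -mulrDr addrC subrK mulr1.
Qed.

Definition site_coding (R : realType) (p : R) :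
    measurableTypeR R -> config_space :=
  fun x v => iter (pickle v) (bit_shift p) x < p.

Lemma measurable_site_coding (R : realType) (p : R) :
  measurable_fun [set: measurableTypeR R] (site_coding p).
Proof.
apply: (@measurability _ _ (measurableTypeR R) config_space _ _ (range occupied)) => // _ [_ [v _ <-] <-].
by rewrite setTI; exact: measurable_bit.
Qed.

HB.instance Definition _ (R : realType) (p : R) :=
  isMeasurableFun.Build _ _ (measurableTypeR R) config_space (site_coding p)
    (measurable_site_coding p).

Lemma site_percolation_exists (R : realType) (p : R) : 0 <= p <= 1 ->
  exists P : probability config_space R, site_percolation p P.
Proof.
move=> p01.
pose X : {mfun measurableTypeR R >-> config_space} := site_coding p.
exists (distribution (uniform_prob (@ltr01 R)) X).
have key (s : seq site) : uniq s ->
    distribution (uniform_prob (@ltr01 R)) X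
      (\bigcap_(i in [set` s]) occupied i) = (p ^+ size s)%:E.
  move=> us; pose S := [seq pickle v | v <- s].
  pose N := (\sum_(n <- S) n.+1)%N.
  pose t := [seq n \in S | n <- iota 0 N].
  have ltN n : n \in S -> (n < N)%N.
    by move=> nS; rewrite /N (big_rem n)//= leq_addr.
  have tn n : nth false t n = (n \in S).
    case: (ltnP n N) => nN.
      by rewrite (nth_map 0%N) ?size_iota// nth_iota.
    rewrite nth_default ?size_map ?size_iota//; apply/esym/negbTE.
    by apply: contraTN nN => /ltN; rewrite -ltnNge.
  have ct : count id t = size s.
    rewrite count_map -(size_map (@pickle _) s) -size_filter.
    apply/perm_size/uniq_perm.
    - by rewrite filter_uniq// iota_uniq.
    - by rewrite map_inj_uniq//; exact: (pcan_inj pickleK).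
    - move=> n; rewrite mem_filter mem_iota add0n /=.
      by apply: andb_idr => /ltN.
  have [mM PM] := has_bits_then_prob t [::] p01.
  have [mD PD] := has_bits_prob [::] p01.
  rewrite {}/X /distribution /pushforward /=.
  set A := (X in uniform_prob _ X = _).
  have mA : measurable (A : set (measurableTypeR R)).
    rewrite /A preimage_bigcap; apply: fin_bigcap_measurable => [|v _]; first exact: finite_seq.
    exact: measurable_bit.
  have AE : A `&` has_bits p [::] = has_bits_then p t [::].
    apply/seteqP; split=> x /=.
      move=> [Ax x01]; split=> // n; rewrite tn => /mapP[v vs ->].
      exact: Ax.
    move=> [x01 h]; split=> // v vs; apply: h; rewrite tn.
    by apply/mapP; exists v.
  have -> : (p ^+ size s)%:E = uniform_prob (@ltr01 R) (A `&` has_bits p [::]).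
    by rewrite AE PM ct /bits_prob big_nil mul1r.
  rewrite -[in LHS](setDUK (@subIsetl _ A (has_bits p [::]))) setDIr setDv set0U.
  rewrite measureU//; [|exact: measurableI|exact: measurableD|]; last first.
    by apply/seteqP; split=> // x [[_ h] [_ h']].
  rewrite [X in (_ + X)%E](_ : _ = 0%E) ?adde0//.
  apply/eqP; rewrite eq_le measure_ge0 andbT.
  have -> : 0%E = uniform_prob (@ltr01 R) (~` has_bits p [::]).
    have h := probability_setC (uniform_prob (@ltr01 R)) mD.
    rewrite (etrans h (congr1 (fun z => 1 - z)%E PD)).
    by rewrite /bits_prob big_nil subee.
  apply: le_measure; rewrite ?inE//; [exact: measurableD|].
  exact: measurableC.
have one v : distribution (uniform_prob (@ltr01 R)) X (occupied v) = p%:E.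
  by have := key [:: v] isT; rewrite set_cons1 bigcap_set1.
split=> // s us; rewrite [RHS](eq_bigr (fun=> p%:E)) => [|v _]; last exact: one.
apply: (etrans (key s us)).
by rewrite prodEFin; congr EFin; rewrite big_const_seq count_predT iter_mulr_1.
Qed.

(* Main.v *)
Require Import Defs.
From Stdlib Require Import BinNat.
From HB Require Import structures.
From mathcomp Require Import all_boot all_order all_algebra.
From mathcomp Require Import all_classical all_reals all_analysis.
From mathcomp Require Import ring lra zify ssrZ.
Import Order.TTheory GRing.Theory Num.Theory.
Import numFieldNormedType.Exports.
(* mathcomp-analysis shadows [adjacent]. *)
Import Defs.
Local Open Scope classical_set_scope.
Local Open Scope ring_scope.

(** Let q(x; V) be the probability that x is joined to infinity by occupied sites outside
    a set V of discarded sites.  Condition on which neighbours of x outside V are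
    occupied.  Among the shortest occupied paths from x to a given site, one whose first
    direction is least never returns to x or its neighbours, and when its first step is d
    its second site x + d + f is not available through an occupied x + f with f < d.  So
    all these sites can be added to V, and a union bound over d bounds q(x; V) by an
    average of sums of q(x + d; V').  What the recursion has to remember is only the last
    direction d0 and the set D of directions still free at x.  At p = 0.253 > 0.2522 a
    positive weight h(d0, D) is multiplied by at most 0.999 in one round, which is a
    finite check; iterating gives q = 0. *)

(** * Directions and steps *)

Definition dirs : seq nat := iota 0 6.

(** Directions 2i and 2i+1 are the two opposite unit vectors along axis i. *)
Definition opp (d : nat) : nat := if odd d then d.-1 else d.+1.

Definition step (x : site) (d : nat) : site :=
  x + (-1) ^+ d *: delta_mx ord0 (inord d./2).

Lemma stepC x d f : step (step x d) f = step (step x f) d.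
Proof. by rewrite /step addrAC. Qed.

Lemma step_opp x d : d \in dirs -> step (step x d) (opp d) = x.
Proof.
have sgn n : (-1) ^+ n = (-1) ^+ odd n :> int by rewrite signr_odd.
rewrite /step (sgn d) (sgn (opp d)).
by case: d => [|[|[|[|[|[|//]]]]]] _ /=;
  rewrite -addrA -scalerDl ?(subrr, addNr) scale0r addr0.
Qed.

Lemma step_inj x : {in dirs &, injective (step x)}.
Proof.
move=> d f dD fD /addrI/rowP e.
have sgn n : (-1) ^+ n = (-1) ^+ odd n :> int by rewrite signr_odd.
have lt3 n : n \in dirs -> (n./2 < 3)%N by rewrite mem_iota; lia.
have := e (inord d./2); rewrite !mxE !eqxx (sgn d) (sgn f).
case: eqVneq => [/(congr1 val)|_]; last by rewrite mulr0; case: (odd d).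
rewrite /= !inordK ?lt3 // => h.
by case od : (odd d); case ev : (odd f) => //= _;
  rewrite -(odd_double_half d) -(odd_double_half f) od ev h.
Qed.

Lemma adjacent_sym x y : adjacent x y = adjacent y x.
Proof. by congr (_ == _); apply: eq_bigr => i _; rewrite -sqrrN opprB. Qed.

Lemma adjacent_step x d : adjacent x (step x d).
Proof.
rewrite /adjacent (bigD1 (inord d./2)) //= big1 => [|i ne]; rewrite !mxE eqxx.
  by rewrite eqxx mulr1 opprD addNKr sqrrN sqrr_sign addr0.
by rewrite (negPf ne) mulr0 addr0 subrr.
Qed.

Lemma sqr_int_ge1 (a : int) : a != 0 -> 1 <= a ^+ 2.
Proof. by move=> a0; rewrite -gtz0_ge1 exprn_even_gt0. Qed.

(** Three integer squares sum to 1 only if one of them is 1 and the others vanish, so a single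
    coordinate changes, by a sign. *)
Lemma adjacentP x y : adjacent x y -> exists2 d, d \in dirs & y = step x d.
Proof.
move=> axy; pose z i := y ord0 i - x ord0 i.
have s1 : \sum_i z i ^+ 2 = 1 by move: axy; rewrite adjacent_sym => /eqP.
have [i zi] : exists i, z i != 0.
  apply/existsP; apply: contra_eqT s1 => /existsPn z0.
  by rewrite big1 // => i _; move: (z0 i); rewrite negbK => /eqP ->; rewrite expr0n.
have sg1 (P : pred 'I_3) : 0 <= \sum_(j | P j) z j ^+ 2.
  by apply: sumr_ge0 => j _; exact: sqr_ge0.
have zi1 : z i ^+ 2 = 1.
  have := sqr_int_ge1 _ zi; have := sg1 (fun j => j != i).
  move: s1; rewrite (bigD1 i) //=; set t := \sum_(_ | _) _; lia.
have zj j : j != i -> z j = 0.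
  move=> ji; apply/eqP/negPn/negP => /sqr_int_ge1.
  have := sg1 (fun k => (k != i) && (k != j)).
  move: s1; rewrite (bigD1 i) //= (bigD1 j) //= zi1.
  set t := \sum_(_ | _) _; lia.
have zb : exists b : bool, z i = (-1) ^+ b.
  by move/eqP: zi1; rewrite sqrf_eq1 => /orP[] /eqP ->; [exists false|exists true].
have [b zE] := zb.
exists (i.*2 + b)%N.
  by rewrite /dirs mem_iota /=; case: i b {zi zi1 zj zE zb} => i i3 [] /=; lia.
have h2 : (i.*2 + b)./2 = i by case: b {zE zb}; lia.
apply/rowP => j; rewrite /step h2 !mxE eqxx inord_val /= -signr_odd oddD odd_double /=.
have -> : odd b = b by case: (b).
have yE : y ord0 j = x ord0 j + z j by rewrite /z addrCA subrr addr0.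
rewrite yE; congr (_ + _).
by have [->|/zj ->] := eqVneq j i; rewrite ?zE ?mulr1 ?mulr0.
Qed.

(** * Shortest paths *)

(** Only the arrival site is tested, so a walk may start at a discarded site without its event
    depending on the state of that site. *)
Definition open_step (w : configuration) (V : pred site) : rel site :=
  fun x y => [&& w y, ~~ V y & adjacent x y].

Definition reach (w : configuration) (V : pred site) (x : site) : set site :=
  [set y | exists2 s, path (open_step w V) x s & y = last x s].

(* Neither [w x] nor [~~ V x] is required. *)
Definition escapes (x : site) (V : pred site) : set configuration :=
  [set w | infinite_set (reach w V x)].

Definition free (x : site) (V : pred site) : seq nat :=
  [seq d <- dirs | ~~ V (step x d)].

Definition open_dirs (w : configuration) (x : site) (D : seq nat) : seq nat :=
  [seq d <- D | w (step x d)].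

(* The last clause is what improves on counting paths without chords: of the two ways
   around a square it keeps only one if both intermediate sites are occupied. *)
Definition explored (x : site) (V : pred site) (O : seq nat) (d : nat) : pred site :=
  fun y => [|| V y, y == x, adjacent x y |
    has (fun f => (f < d)%N && (y == step (step x d) f)) O].

Lemma escapes_split w x V : escapes x V w ->
  exists2 d, d \in open_dirs w x (free x V) &
    escapes (step x d) (explored x V (open_dirs w x (free x V)) d) w.
Proof.
set O := open_dirs _ _ _ => esc.
pose U d := reach w (explored x V O d) (step x d).
(* The reached set is covered by [x] and finitely many sets [U d], so if it is infinite, one of
   these is. *)
have sub : reach w V x `<=` [set x] `|` \bigcup_(d in [set` O]) U d.
  move=> y; case/pselect: (y = x) => [->|yx]; first by left.
  move=> [s0 ps0 ys0]; right.
  (* As [d < 6], this orders paths by length, then by first direction. *)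
  pose m (d : nat) (s : seq site) := (size s * 6 + d)%N.
  pose Q (d : nat) (s : seq site) :=
    [/\ d \in dirs, path (open_step w V) x (step x d :: s) & y = last (step x d) s].
  have [d0 [s1 Q0]] : exists d s, Q d s.
    case: s0 ps0 ys0 => [|v s] //= /andP[xv ps] ys.
    have [d dD vE] : exists2 d, d \in dirs & v = step x d.
      by apply: adjacentP; case/and3P: xv.
    by exists d, s; rewrite vE in xv ps ys; split=> //=; rewrite xv.
  have exQ : exists n, `[< exists d s, Q d s /\ m d s = n >].
    by exists (m d0 s1); apply/asboolP; exists d0, s1.
  case: (ex_minnP exQ) => n /asboolP[d [s [Qds mn]]] min.
  have {}min d' s' : Q d' s' -> (m d s <= m d' s')%N.
    by move=> Q'; rewrite mn; apply: min; apply/asboolP; exists d', s'.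
  case: Qds => dD /= /andP[xd ps] ys.
  have dO : d \in O.
    by case/and3P: xd => wd Vd _; rewrite !mem_filter wd Vd.
  exists d => //; exists s => //.
  have lt6 f : f \in dirs -> (f < 6)%N by rewrite mem_iota.
  have d6 := lt6 _ dD.
  (* A discarded site [z] on the minimal path would give a smaller one: restart after [z] if it is
     [x], step straight from [x] to [z] if it is a neighbour, or go round the square through
     [step x f], which is no longer and has the smaller first direction [f]. *)
  have avoid s1' z s2 : s = s1' ++ z :: s2 -> open_step w V (last (step x d) s1') z ->
      path (open_step w V) z s2 -> ~~ explored x V O d z.
    move=> sE zo pz; apply/negP; rewrite sE in ys min.
    have yz : y = last z s2 by rewrite ys last_cat.
    case/and3P: zo => wz Vz az.
    rewrite /explored (negPf Vz) /= => /or3P[/eqP zx|xz|/hasP[f fO /andP[fd /eqP zE]]].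
    - case: s2 {sE ys} min pz yz => [|v s2] min /=; first by rewrite zx.
      rewrite zx => /andP[xv pv] yv.
      have [d' d'D vE] : exists2 d, d \in dirs & v = step x d.
        by apply: adjacentP; case/and3P: xv.
      have : Q d' s2 by rewrite vE in xv pv yv; split=> //=; rewrite xv.
      move/min; rewrite /m size_cat /=; have := lt6 _ d'D; lia.
    - have [d' d'D zE] := adjacentP _ _ xz.
      have : Q d' s2.
        by split; rewrite -?zE //= pz andbT /open_step wz Vz.
      by move/min; rewrite /m size_cat /=; have := lt6 _ d'D; lia.
    - move: fO; rewrite !mem_filter => /and3P[wf Vf fD].
      have : Q f (z :: s2).
        split=> //=; rewrite pz /open_step wf Vf wz Vz adjacent_step /=.
        by rewrite zE stepC adjacent_step.
      by move/min; rewrite /m size_cat /=; lia.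
  have key s1' s2 : s = s1' ++ s2 -> path (open_step w V) (last (step x d) s1') s2 ->
      path (open_step w (explored x V O d)) (last (step x d) s1') s2.
    elim: s2 s1' => [//|z s2 IH] s1' sE /= /andP[zo pz].
    have := IH (rcons s1' z); rewrite cat_rcons last_rcons => /(_ sE pz) ->.
    rewrite andbT /open_step (avoid _ _ _ sE zo pz).
    by case/and3P: zo => -> _ ->.
  exact: (key [::]).
case/pselect: (exists2 d, d \in O & escapes (step x d) (explored x V O d) w) => // no.
exfalso; apply: esc; apply: sub_finite_set sub _; rewrite finite_setU; split.
  exact: finite_set1.
apply: bigcup_finite => // d dO; apply: contrapT => inf; apply: no.
by exists d.
Qed.

(** * The weight *)

Fixpoint sublists (T : Type) (s : seq T) : seq (seq T) :=
  if s is x :: s' then map (cons x) (sublists T s') ++ sublists T s' else [:: [::]].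
Arguments sublists {T} s.

Lemma filter_sublists (T : eqType) (a : pred T) (s : seq T) : [seq x <- s | a x] \in sublists s.
Proof.
elim: s => //= x s IH; rewrite mem_cat; case: (a x); last by rewrite IH orbT.
by rewrite map_f.
Qed.

Lemma size_sublists (T : eqType) (s t : seq T) : t \in sublists s -> (size t <= size s)%N.
Proof.
elim: s t => [|x s IH] t /=; first by rewrite inE => /eqP ->.
by rewrite mem_cat => /orP[/mapP[u /IH us ->]//|/IH]; exact: leqW.
Qed.

Lemma sublists_subset (T : eqType) (s t : seq T) : t \in sublists s -> {subset t <= s}.
Proof.
elim: s t => [|x s IH] t /=; first by rewrite inE => /eqP ->.
rewrite mem_cat => /orP[/mapP[u us ->]|ts] y.
  by rewrite !in_cons => /orP[->//|/(IH _ us) ->]; rewrite orbT.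
by move=> /(IH _ ts); rewrite in_cons orbC => ->.
Qed.

(** Each counted pair is perpendicular and spans a lattice square at the current site. It lowers the
    weight because only one way around the square is kept when both intermediate sites are
    occupied. *)
Definition corners (D : seq nat) : nat :=
  sumn [seq count (fun f => (f < d)%N && (f./2 != d./2)) D | d <- D].

(* A rounding of the Perron eigenvector of the recursion [prob_escapes_le] at
   p = 253/1000, where the eigenvalue is about 0.9956; the 1 makes it positive. *)
Definition weight (d0 : nat) (D : seq nat) : nat :=
  18 * size D + 4 * (d0 \in D) + 1 - corners D.

(** The excluded directions lead from [step x d] back to [x], to a neighbour of the site before [x],
    or to a square corner discarded by the last clause of [explored]. *)
Definition next_dirs (d0 : nat) (O : seq nat) (d : nat) : seq nat :=
  [seq f <- dirs | [&& f != opp d, f != opp d0 & ~~ ((f < d)%N && (f \in O))]].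

Definition next_weight (d0 : nat) (O : seq nat) : nat :=
  sumn [seq weight d (next_dirs d0 O d) | d <- O].

(** More sites may be discarded than the recursion remembers; this monotonicity, a finite check,
    absorbs the difference. *)
Lemma leq_weight d0 D D' : d0 \in dirs -> D \in sublists dirs ->
  D' \in sublists D -> (weight d0 D' <= weight d0 D)%N.
Proof.
have /allP h : all (fun d0 => all (fun D => all (fun D' => weight d0 D' <= weight d0 D)%N
  (sublists D)) (sublists dirs)) dirs by vm_compute.
by move=> /h /allP h0 /h0 /allP; apply.
Qed.

Lemma weight_gt0 d0 D : d0 \in dirs -> D \in sublists dirs -> (0 < weight d0 D)%N.
Proof.
have /allP h : all (fun d0 => all (fun D => 0 < weight d0 D)%N (sublists dirs)) dirs.
  by vm_compute.
by move=> /h /allP; apply.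
Qed.

Definition powN (a : N) (k : nat) : N := iter k (N.mul a) 1%num.

(* The returned equation says [lhs <= rhs], as subtraction in [N] is truncated. *)
Definition weight_drop (d0 : nat) (D : seq nat) : bool :=
  let lhs := foldr (fun O r =>
    (1000 * (powN 253 (size O) * powN 747 (size D - size O)
      * bin_of_nat (next_weight d0 O)) + r)%num) 0%num (sublists D) in
  let rhs := (999 * powN 1000 (size D) * bin_of_nat (weight d0 D))%num in
  (lhs + (rhs - lhs) == rhs)%num.

(** The case [opp d0 \in D] is excused: that direction leads back to the previous site, which is
    always discarded. *)
Lemma weight_dropT : all (fun d0 => all (fun D => (opp d0 \in D) || weight_drop d0 D)
  (sublists dirs)) dirs.
Proof. by vm_compute. Qed.

Lemma clear_denominators (F : fieldType) (a b c z : F) (m n : nat) : c != 0 ->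
  a ^+ m * b ^+ n * z = c ^+ (m + n) * ((a / c) ^+ m * (b / c) ^+ n * z).
Proof.
move=> c0; rewrite !expr_div_n exprD.
have := expf_neq0 m c0; have := expf_neq0 n c0.
move: (a ^+ m) (b ^+ n) (c ^+ m) (c ^+ n) => A B C1 C2 C20 C10.
by field; rewrite ?C10 ?C20.
Qed.

Definition bits_weight (R : realType) (p : R) (D O : seq nat) : R :=
  p ^+ size O * (1 - p) ^+ (size D - size O).

(** This is the integer check [weight_dropT] divided by 1000^(size D + 1), carried from binary
    numbers to [R] by [rN]. *)
Lemma expected_weight (R : realType) (d0 : nat) (D : seq nat) :
  d0 \in dirs -> D \in sublists dirs -> opp d0 \notin D ->
  \sum_(O <- sublists D) bits_weight R (253 / 1000) D O * (next_weight d0 O)%:R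
    <= 999 / 1000 * (weight d0 D)%:R.
Proof.
move=> d0D DD oD; pose rN (n : N) : R := (nat_of_bin n)%:R.
have /allP/(_ _ d0D)/allP/(_ _ DD) := weight_dropT.
rewrite (negPf oD) /= /weight_drop; set F := (fun O r => _); set rhs := (X in _ == X).
have rD a b : rN (a + b)%num = rN a + rN b.
  by rewrite /rN -natrD; congr _%:R; exact: (rmorphD nat_of_bin).
have rM a b : rN (a * b)%num = rN a * rN b.
  by rewrite /rN -natrM; congr _%:R; exact: (rmorphM nat_of_bin).
have rX a k : rN (powN a k) = rN a ^+ k.
  by elim: k => [|k IH]; rewrite ?expr0 // exprS -IH -rM.
have rB n : rN (bin_of_nat n) = n%:R by rewrite /rN bin_of_natK.
have [r253 r747 r1000] : [/\ rN 253 = 253, rN 747 = 747 & rN 1000 = 1000] by [].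
have pE : 253 / 1000 = rN 253 / rN 1000 by rewrite r253 r1000.
have qE : 1 - rN 253 / rN 1000 = rN 747 / rN 1000 by rewrite r253 r1000 r747; lra.
have rE : 999 / 1000 = rN 999 / rN 1000 by rewrite r1000.
have c0 : 0 < rN 1000 by rewrite r1000 ltr0n.
move=> /eqP/(congr1 rN); rewrite rD => lrE.
have : rN (foldr F 0%num (sublists D)) <= rN rhs by rewrite -lrE lerDl ler0n.
rewrite /rhs !rM rX rB.
have -> : rN (foldr F 0%num (sublists D)) = \sum_(O <- sublists D) rN 1000 *
    (rN 253 ^+ size O * rN 747 ^+ (size D - size O) * (next_weight d0 O)%:R).
  by elim: (sublists D) => [|O s IH]; rewrite ?big_nil // big_cons /= rD !rM !rX rB IH.
rewrite pE rE /bits_weight qE.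
move: (rN 253) (rN 747) (rN 999) (rN 1000) c0 => a b e c c0.
rewrite -mulr_sumr.
have -> : \sum_(O <- sublists D) a ^+ size O * b ^+ (size D - size O) * (next_weight d0 O)%:R
  = c ^+ size D * \sum_(O <- sublists D)
      (a / c) ^+ size O * (b / c) ^+ (size D - size O) * (next_weight d0 O)%:R.
  rewrite mulr_sumr big_seq [RHS]big_seq; apply: eq_bigr => O /size_sublists sO.
  by rewrite (clear_denominators _ _ _ c) ?subnKC // gt_eqF.
have -> : e * c ^+ size D * (weight d0 D)%:R = c * (c ^+ size D * (e / c * (weight d0 D)%:R)).
  by move: (c ^+ _) (weight _ _)%:R => x y; field; rewrite gt_eqF.
by rewrite ler_pM2l // ler_pM2l ?exprn_gt0.
Qed.

(** * Measurability and independence *)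

Lemma measurable_occupied x : measurable (occupied x : set config_space).
Proof. by apply: sub_sigma_algebra; exists x. Qed.

Lemma measurable_path V x s :
  measurable ([set w | path (open_step w V) x s] : set config_space).
Proof.
elim: s x => [|y s IH] x /=.
  by rewrite (_ : mkset _ = setT) //; apply/seteqP; split.
have [xy|xy] := boolP (~~ V y && adjacent x y).
  rewrite (_ : mkset _ = occupied y `&` [set w | path (open_step w V) y s]).
    by apply: measurableI => //; exact: measurable_occupied.
  by apply/seteqP; split => w /=; rewrite /open_step xy andbT => /andP.
rewrite (_ : mkset _ = set0) //; apply/seteqP; split => w //=.
by rewrite /open_step (negPf xy) andbF.
Qed.

Lemma infinite_setP (T : eqType) (A : set T) :
  infinite_set A <-> forall s : seq T, exists2 x, x \notin s & A x.
Proof.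
split=> [inf s|h /finite_seqP[s As]].
  apply: contrapT => no; apply: inf; apply: sub_finite_set (finite_seq s) => x Ax /=.
  by apply: contrapT => /negP xs; apply: no; exists x.
by have [x /negP xs] := h s; rewrite As.
Qed.

(** An infinite set is one that leaves every finite list, and a site is reached by a finite path, so
    the event is a countable intersection of countable unions of path events. *)
Lemma measurable_escapes x V : measurable (escapes x V : set config_space).
Proof.
rewrite (_ : escapes x V = \bigcap_(s in @setT (seq site)) \bigcup_(t in @setT (seq site))
    [set w | path (open_step w V) x t /\ last x t \notin s]); last first.
  apply/seteqP; split => w.
    move=> /infinite_setP h s _; have [y ys [t pt yt]] := h s.
    by exists t => //; split=> //; rewrite -yt.
  move=> h; apply/infinite_setP => s; have [t _ [pt ts]] := h s I.
  by exists (last x t) => //; exists t.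
rewrite -[X in measurable X]setCK setC_bigcap; apply: measurableC.
apply: countable_bigcupT_measurable => // s; apply: measurableC.
apply: countable_bigcupT_measurable => // t.
have [ts|ts] := boolP (last x t \in s).
  by rewrite (_ : mkset _ = set0) //; apply/seteqP; split => w //= [].
rewrite (_ : mkset _ = [set w | path (open_step w V) x t]); first exact: measurable_path.
by apply/seteqP; split => w //= [].
Qed.

Definition ignores (x : site) (B : set configuration) : Prop :=
  forall w w', (forall y, y != x -> w y = w' y) -> B w -> B w'.

Lemma escapes_ignores x (V : pred site) z : V z -> ignores z (escapes x V).
Proof.
move=> Vz w w' ww'; rewrite /escapes /=; congr (~ finite_set _).
apply/seteqP; split => y [s ps ys]; exists s => //; move: ps; apply: sub_path => a b;
  rewrite /open_step => /and3P[wb Vb ->];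
  have bz : b != z by apply/eqP => bz; rewrite bz Vz in Vb.
  by rewrite -ww' // wb Vb.
by rewrite ww' // wb Vb.
Qed.

Lemma escapes_mono x (V V' : pred site) : (forall z, V' z -> V z) -> escapes x V `<=` escapes x V'.
Proof.
move=> VV' w; apply: contra_not; apply: sub_finite_set => y [s ps ys].
exists s => //; move: ps; apply: sub_path => a b /and3P[wb Vb ab].
by rewrite /open_step wb ab andbT /=; apply: contra Vb; exact: VV'.
Qed.

Definition vacate (x : site) : config_space -> config_space :=
  fun w y => (y != x) && w y.

Lemma measurable_vacate x : measurable_fun [set: config_space] (vacate x).
Proof.
apply: (@measurability _ _ config_space config_space _ _ (range occupied)) => // _ [_ [v _ <-] <-].
rewrite setTI; have [->|vx] := eqVneq v x.
  rewrite (_ : _ @^-1` _ = set0) //; apply/seteqP; split => w //=.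
  by rewrite /occupied /= /vacate eqxx.
rewrite (_ : _ @^-1` _ = occupied v); first exact: measurable_occupied.
by apply/seteqP; split => w /=; rewrite /occupied /= /vacate vx.
Qed.

Lemma ignores_vacate x B : ignores x B -> vacate x @^-1` B = B.
Proof.
move=> iB; apply/seteqP; split => w; apply: iB => y yx; by rewrite /vacate yx.
Qed.

Definition pattern (x : site) (D O : seq nat) : set configuration :=
  [set w | open_dirs w x D = O].

Lemma pattern_ignores x D O z : (forall d, d \in D -> step x d != z) ->
  ignores z (pattern x D O).
Proof.
move=> zD w w' ww' <-; apply: eq_in_filter => d dD.
by rewrite ww' // zD.
Qed.

Lemma ignoresI z A B : ignores z A -> ignores z B -> ignores z (A `&` B).
Proof. by move=> hA hB w w' ww' [Aw Bw]; split; [exact: hA Aw|exact: hB Bw]. Qed.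

Lemma pattern_cons x d D O :
  pattern x (d :: D) O = occupied (step x d) `&`
      (if O is f :: O' then (if f == d then pattern x D O' else set0) else set0)
    `|` ~` occupied (step x d) `&` pattern x D O.
Proof.
apply/seteqP; split => w; rewrite /pattern /open_dirs /= /occupied /=.
  by case: ifP => wd <-; [left|right]; rewrite ?eqxx //; split=> //; rewrite wd.
case: ifP => wd [[]|[]] //; case: O => //= f O _.
by case: eqP => [->|//] /= ->.
Qed.

Lemma measurable_pattern x D O : measurable (pattern x D O : set config_space).
Proof.
elim: D O => [|d D IH] O.
  have [->|O0] := eqVneq O [::].
    by rewrite (_ : pattern _ _ _ = setT) //; apply/seteqP; split.
  rewrite (_ : pattern _ _ _ = set0) //; apply/seteqP; split => w //= /esym/eqP.
  by rewrite (negPf O0).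
have md := measurable_occupied (step x d).
rewrite pattern_cons; apply: measurableU; apply: measurableI => //.
  by case: O => // f O; case: eqP.
exact: measurableC.
Qed.

(** * Independence of sites and the recursion for escape probabilities *)

Section percolation.
Context (R : realType) (p : R) (P : probability config_space R).
Hypothesis perc : site_percolation p P.

Definition cylinder : set (set configuration) :=
  [set B | exists s : seq site, B = \bigcap_(i in [set` s]) occupied i].

Lemma measurable_cylinder (s : seq site) :
  measurable (\bigcap_(i in [set` s]) occupied i : set config_space).
Proof.
apply: fin_bigcap_measurable => [|v _]; first exact: finite_seq.
exact: measurable_occupied.
Qed.

Lemma prob_cylinder (s : seq site) : uniq s ->
  P (\bigcap_(i in [set` s]) occupied i) = (p ^+ size s)%:E.
Proof.
move=> us; rewrite perc.1 // (eq_bigr (fun=> p%:E)) => [|v _]; last exact: perc.2.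
by rewrite prodEFin; congr EFin; rewrite big_const_seq count_predT iter_mulr_1.
Qed.

Let fP A : measurable A -> P A \is a fin_num.
Proof. by move=> mA; exact: fin_num_measure. Qed.

(* Every [vacate x @^-1` B] ignores [x], and conversely, so that the pi-lambda argument
   can run over all measurable [B]. *)
Lemma prob_occupiedI x (B : set config_space) : measurable B -> ignores x B ->
  P (occupied x `&` B) = (p%:E * P B)%E.
Proof.
move=> mB /ignores_vacate <-; move: B mB.
have mv B : measurable B -> measurable (vacate x @^-1` B).
  by move=> mB; rewrite -[X in measurable X]setTI; exact: measurable_vacate.
have gen : @measurable _ config_space = <<s cylinder >>.
  apply/seteqP; split; apply: smallest_sub; try exact: smallest_sigma_algebra.
  - move=> _ [v _ <-]; apply: sub_sigma_algebra; exists [:: v].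
    by rewrite set_cons1 bigcap_set1.
  - by move=> _ [s ->]; exact: measurable_cylinder.
rewrite {1}gen.
apply: (@dynkin_induction _ config_space cylinder
  (fun B => P (occupied x `&` vacate x @^-1` B) = (p%:E * P (vacate x @^-1` B))%E) gen).
- move=> _ _ [s ->] [t ->]; exists (s ++ t); apply/seteqP; split => w /=.
    by move=> [h1 h2] v /=; rewrite mem_cat => /orP[/h1|/h2].
  by move=> h; split => v vs; apply: h; rewrite /= mem_cat vs ?orbT.
- by rewrite preimage_setT setIT probability_setT mule1; exact: perc.2.
- move=> _ [s ->].
  (* If [x] is in [s], no vacated configuration lies in the cylinder and both sides are 0; otherwise
     adding [x] to [s] contributes one more factor [p]. *)
  have [xs|xs] := boolP (x \in s).
    rewrite (_ : _ @^-1` _ = set0); last first.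
      by apply/seteqP; split => w //= /(_ x xs); rewrite /occupied /= /vacate eqxx.
    by rewrite setI0 measure0 mule0.
  rewrite ignores_vacate; last first.
    move=> w w' ww' h v vs; rewrite /occupied /= -ww'; first exact: h.
    by apply: contraNneq xs => <-.
  have sE : [set` s] = [set` undup s] by apply/seteqP; split => v /=; rewrite mem_undup.
  rewrite sE prob_cylinder ?undup_uniq //.
  rewrite (_ : _ `&` _ = \bigcap_(i in [set` x :: undup s]) occupied i).
    by rewrite prob_cylinder /= ?mem_undup ?xs ?undup_uniq // exprS EFinM.
  apply/seteqP; split => w /=.
    by move=> [wx h] v; rewrite /= in_cons => /predU1P[->//|]; exact: h.
  by move=> h; split=> [|v vs]; apply: h; rewrite /= in_cons ?eqxx // vs orbT.
- move=> S mS IS; have mvS := mv _ mS; have mx := measurable_occupied x.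
  (* Splitting [occupied x] along the preimage of [S] yields the formula for the complement by
     subtraction. *)
  have h : p%:E = (P (occupied x `&` ~` (vacate x @^-1` S)) + p%:E * P (vacate x @^-1` S))%E.
    by rewrite -IS -setDE -(perc.2 x); exact: (measureDI P mx mvS).
  have -> : P (vacate x @^-1` (~` S)) = (1 - P (vacate x @^-1` S))%E.
    exact: probability_setC mvS.
  have fS := fP _ mvS.
  rewrite muleBr ?fin_num_adde_defl ?fin_numN // mule1.
  have : (p%:E * P (vacate x @^-1` S))%E \is a fin_num by rewrite fin_numM.
  by move: (p%:E * _)%E h => c -> cf; rewrite addeK.
- move=> F mF tF IF; rewrite preimage_bigcup setI_bigcupr.
  have tv : trivIset setT (fun i => vacate x @^-1` F i).
    by move=> i j Di Dj [w [Fi Fj]]; apply: tF => //; exists (vacate x w).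
  rewrite !measure_bigcup //.
  + rewrite -nneseriesZl => [|i _]; last exact: measure_ge0.
    by apply: eq_eseriesr => i _; exact: IF.
  + by move=> i _; exact: mv.
  + by move=> i _; apply: measurableI; [exact: measurable_occupied|exact: mv].
  + exact: trivIset_setIl.
Qed.
Definition prob (A : set config_space) : R := fine (P A).

Lemma probE A : measurable A -> P A = (prob A)%:E.
Proof. by move=> mA; rewrite fineK // fin_num_measure. Qed.

Lemma prob_ge0 A : 0 <= prob A.
Proof. by rewrite fine_ge0. Qed.

Lemma prob_le1 A : measurable A -> prob A <= 1.
Proof. by move=> mA; rewrite -lee_fin -probE // probability_le1. Qed.

Lemma prob_set0 : prob set0 = 0.
Proof. by rewrite /prob measure0. Qed.

Lemma prob_mono A B : measurable A -> measurable B -> A `<=` B -> prob A <= prob B.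
Proof. by move=> mA mB AB; rewrite -lee_fin -!probE // le_measure ?inE. Qed.

Lemma prob_split A B : measurable A -> measurable B ->
  prob B = prob (A `&` B) + prob (~` A `&` B).
Proof.
move=> mA mB; have mC := measurableC mA.
apply: EFin_inj; rewrite EFinD -!probE //; try exact: measurableI.
by rewrite [LHS](measureDI P mB mA) addeC setDE setIC (setIC B).
Qed.

Lemma prob_bigU_le (I : eqType) (s : seq I) (F : I -> set config_space) (A : set config_space) :
  measurable A -> (forall i, i \in s -> measurable (F i)) ->
  (forall w, A w -> exists2 i, i \in s & F i w) ->
  prob A <= \sum_(i <- s) prob (F i).
Proof.
elim: s A => [|i s IH] A mA mF AF.
  rewrite big_nil (_ : A = set0) ?prob_set0 //.
  by apply/seteqP; split => w // /AF[].
have mi : measurable (F i) by apply: mF; rewrite mem_head.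
rewrite big_cons (prob_split (F i)) // lerD //.
  by apply: prob_mono => //; exact: measurableI.
apply: IH => [|j js|w [nFi /AF[j]]]; last first.
- by rewrite in_cons => /predU1P[->//|js Fj]; exists j.
- by apply: mF; rewrite in_cons js orbT.
- by apply: measurableI => //; exact: measurableC.
Qed.

Lemma indep_occupied x (B : set config_space) : measurable B -> ignores x B ->
  prob (occupied x `&` B) = p * prob B.
Proof.
move=> mB iB; apply: EFin_inj; rewrite EFinM -!probE //.
  exact: prob_occupiedI.
by apply: measurableI => //; exact: measurable_occupied.
Qed.

Lemma indep_vacant x (B : set config_space) : measurable B -> ignores x B ->
  prob (~` occupied x `&` B) = (1 - p) * prob B.
Proof.
move=> mB iB; have := prob_split _ _ (measurable_occupied x) mB.
by rewrite indep_occupied // mulrBl mul1r => {1}->; rewrite addrAC subrr add0r.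
Qed.

(** Neighbours are peeled off one at a time: the state of [step x d] is independent of the pattern
    in the remaining directions intersected with [C], which gives a factor [p] or [1 - p]. *)
Lemma prob_pattern x D O (C : set config_space) :
  uniq D -> {subset D <= dirs} -> O \in sublists D -> measurable C ->
  (forall d, d \in D -> ignores (step x d) C) ->
  prob (pattern x D O `&` C) = bits_weight R p D O * prob C.
Proof.
move=> + + + mC; elim: D O => [|d D IH] O /=.
  rewrite inE => _ _ /eqP -> _; rewrite /bits_weight !expr0 !mul1r.
  by congr prob; apply/seteqP; split => w // [].
move=> /andP[dD uD] sD OD iC.
have dd : d \in dirs by apply: sD; rewrite mem_head.
have {}sD : {subset D <= dirs} by move=> f fD; apply: sD; rewrite in_cons fD orbT.
have iD O' : ignores (step x d) (pattern x D O' `&` C).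
  apply: ignoresI; last by apply: iC; rewrite mem_head.
  apply: pattern_ignores => f fD; apply: contraNneq dD => /step_inj <- //.
  exact: sD.
have {}iC f : f \in D -> ignores (step x f) C by move=> fD; apply: iC; rewrite in_cons fD orbT.
have mD O' : measurable (pattern x D O' `&` C : set config_space).
  by apply: measurableI => //; exact: measurable_pattern.
have mO := measurable_occupied (step x d).
rewrite (prob_split (occupied (step x d))) //; last first.
  by apply: measurableI => //; exact: measurable_pattern.
have -> : ~` occupied (step x d) `&` (pattern x (d :: D) O `&` C) =
    ~` occupied (step x d) `&` (pattern x D O `&` C).
  rewrite pattern_cons; apply/seteqP; split => w.
    by move=> [nd [[[] | [_ h] ] h2] ].
  by move=> [nd [? ?]]; split=> //; split=> //; right.
rewrite indep_vacant //.
(* Either [O] begins with [d] and only the occupied half contributes, or [d] is absent from [O] and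
   only the vacant half does. *)
move: OD; rewrite mem_cat => /orP[/mapP[U UD ->]|OD].
  have -> : occupied (step x d) `&` (pattern x (d :: D) (d :: U) `&` C) =
      occupied (step x d) `&` (pattern x D U `&` C).
    rewrite pattern_cons eqxx; apply/seteqP; split => w.
      by move=> [od [[[_ h] | [] ] h2] ].
    by move=> [od [? ?]]; split=> //; split=> //; left.
  rewrite indep_occupied // IH // (_ : pattern x D (d :: U) `&` C = set0).
    by rewrite prob_set0 mulr0 addr0 mulrA /bits_weight /= subSS exprS !mulrA.
  apply/seteqP; split => w // [+ _] => /(congr1 (fun s => d \in s)).
  by rewrite mem_head mem_filter (negPf dD) andbF.
have -> : occupied (step x d) `&` (pattern x (d :: D) O `&` C) = set0.
  rewrite pattern_cons; apply/seteqP; split => w //.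
  move=> [od [[[_ +] | [] ] _] ] //; case: O OD => // f O /sublists_subset sO.
  case: eqP => // fd; have := sO f; rewrite mem_head fd => /(_ isT).
  by rewrite (negPf dD).
rewrite prob_set0 add0r IH // /bits_weight /= subSn ?size_sublists //.
by rewrite exprS [in RHS]mulrCA !mulrA.
Qed.

(** Two union bounds: over the set [O] of occupied free directions, then over the first direction
    supplied by [escapes_split]. *)
Lemma prob_escapes_le x V :
  prob (escapes x V) <= \sum_(O <- sublists (free x V))
    bits_weight R p (free x V) O * \sum_(d <- O) prob (escapes (step x d) (explored x V O d)).
Proof.
set D := free x V.
have sD : {subset D <= dirs} by move=> d; rewrite mem_filter => /andP[].
have mE d O : measurable (escapes (step x d) (explored x V O d) : set config_space).
  exact: measurable_escapes.
pose F O : set config_space := pattern x D O `&` escapes x V.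
have mF O : measurable (F O).
  by apply: measurableI; [exact: measurable_pattern|exact: measurable_escapes].
apply: (le_trans (prob_bigU_le _ (sublists D) F _ _ _ _)) => //.
- exact: measurable_escapes.
- by move=> w ew; exists (open_dirs w x D); [exact: filter_sublists|].
rewrite big_seq [leRHS]big_seq; apply: ler_sum => O OD; rewrite mulr_sumr.
pose G d : set config_space := pattern x D O `&` escapes (step x d) (explored x V O d).
apply: (le_trans (prob_bigU_le _ O G _ (mF O) _ _)) => [d _|w [wO]|].
- by apply: measurableI => //; exact: measurable_pattern.
- by move=> /escapes_split[d]; rewrite -/D wO => dO ed; exists d.
rewrite big_seq [leRHS]big_seq; apply: ler_sum => d dO.
(* All neighbours of [x] are in the explored set, so the onward escape ignores the pattern and the
   probability factors. *)
rewrite prob_pattern // ?filter_uniq // => f fD.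
by apply: escapes_ignores; rewrite /explored adjacent_step !orbT.
Qed.

End percolation.

(** * Extinction *)

Lemma explored_free x (V : pred site) O d d0 y : d0 \in dirs -> d \in dirs -> x = step y d0 ->
    (forall f, f \in dirs -> V (step y f)) ->
  free (step x d) (explored x V O d) \in sublists (next_dirs d0 O d).
Proof.
move=> d0D dD xE Vy.
rewrite (_ : free _ _ = [seq f <- next_dirs d0 O d | ~~ explored x V O d (step (step x d) f)]).
  exact: filter_sublists.
rewrite /free /next_dirs -filter_predI; apply: eq_in_filter => f fD /=.
apply/idP/idP => [ex|/andP[]//]; rewrite ex /=; apply/and3P; split.
- by apply: contraNneq ex => ->; rewrite /explored step_opp // eqxx orbT.
(* The site [step (step x d) (opp d0)] is [step y d], a neighbour of [y], hence in [V]. *)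
- apply: contraNneq ex => ->.
  by rewrite stepC xE step_opp // /explored Vy.
- apply: contraNN ex => /andP[fd fO]; rewrite /explored; apply/or4P/Or44/hasP.
  by exists f; rewrite ?fd ?eqxx.
Qed.

Section extinction.
Context (R : realType) (p rho : R) (P : probability config_space R).
Hypothesis perc : site_percolation p P.
Hypotheses (p0 : 0 <= p) (p1 : p <= 1) (rho0 : 0 <= rho) (rho1 : rho < 1).
Hypothesis weight_contracts : forall d0 D, d0 \in dirs -> D \in sublists dirs -> opp d0 \notin D ->
  \sum_(O <- sublists D) bits_weight R p D O * (next_weight d0 O)%:R
    <= rho * (weight d0 D)%:R.

(** Here [y] is the site visited before. That it and its neighbours are discarded is an invariant
    which [explored] restores in every round, and every round gains a factor [rho]. *)
Lemma prob_escapes_geometric n y d0 (V : pred site) : d0 \in dirs -> V y ->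
    (forall f, f \in dirs -> V (step y f)) ->
  prob R P (escapes (step y d0) V)
    <= (weight d0 (free (step y d0) V))%:R * rho ^+ n.
Proof.
elim: n y d0 V => [|n IH] y d0 V d0D Vy Vs; set x := step y d0.
  (* The weight is a positive integer, so it is at least any probability. *)
  rewrite mulr1 (le_trans (prob_le1 _ _ _ (measurable_escapes x V))) // ler1n.
  by rewrite weight_gt0 // filter_sublists.
apply: (le_trans (prob_escapes_le _ _ _ perc x V)).
set D := free x V.
have DD : D \in sublists dirs by exact: filter_sublists.
have oD : opp d0 \notin D by rewrite mem_filter /x step_opp // Vy.
rewrite exprSr mulrA mulrAC; set r := _ ^+ n.
have r0 : 0 <= r by rewrite exprn_ge0.
apply: (@le_trans _ _ ((\sum_(O <- sublists D)
    bits_weight R p D O * (next_weight d0 O)%:R) * r)); last first.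
  by rewrite ler_wpM2r // mulrC weight_contracts.
rewrite mulr_suml big_seq [leRHS]big_seq; apply: ler_sum => O OD.
rewrite -mulrA ler_wpM2l //.
  by rewrite mulr_ge0 // exprn_ge0 // subr_ge0.
rewrite /next_weight sumnE big_map natr_sum mulr_suml big_seq [leRHS]big_seq.
apply: ler_sum => d dO.
have dD : d \in dirs by apply: (sublists_subset _ _ _ DD); exact: (sublists_subset _ _ _ OD).
apply: (le_trans (IH x d _ dD _ _)).
- by rewrite /explored eqxx orbT.
- by move=> f fD; rewrite /explored adjacent_step !orbT.
rewrite ler_wpM2r // ler_nat leq_weight //; first exact: filter_sublists.
exact: (explored_free x V O d d0 y).
Qed.

Lemma prob_escapes_eq0 y d0 (V : pred site) : d0 \in dirs -> V y ->
    (forall f, f \in dirs -> V (step y f)) ->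
  prob R P (escapes (step y d0) V) = 0.
Proof.
move=> d0D Vy Vs; apply/eqP; rewrite eq_le prob_ge0 andbT.
have /cvgr_to_ge : geometric ((weight d0 (free (step y d0) V))%:R : R) rho x @[x --> \oo] --> 0.
  by apply: cvg_geometric; rewrite ger0_norm.
by apply; apply: nearW => n; exact: prob_escapes_geometric.
Qed.

Lemma no_infinite_component : {ae P, forall w, ~ has_infinite_component w}.
Proof.
pose V (x : site) : pred site := fun y => (y == x) || adjacent x y.
(* The exceptional set is covered by countably many null events, one per site and direction; codes
   of no such pair give the empty event. *)
pose F (n : nat) : set config_space :=
  if unpickle n is Some (x, d) then
    (if d \in dirs then escapes (step x d) (V x) else set0) else set0.
have nF n : P.-negligible (F n).
  rewrite /F; case: unpickle => [[x d]|]; last exact: negligible_set0.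
  case: ifP => dD; last exact: negligible_set0.
  have mE := measurable_escapes (step x d) (V x).
  apply/negligibleP => //; apply: (etrans (probE _ P _ mE)); rewrite prob_escapes_eq0 //.
  - by rewrite /V eqxx.
  - by move=> f fD; rewrite /V adjacent_step orbT.
apply: negligibleS (negligible_bigcup nF) => w /contrapT[x wx inf].
(* With nothing discarded, the reached set contains the whole component of [x]. *)
have : escapes x pred0 w.
  apply: contra_not inf; apply: sub_finite_set => y [s ps ys]; exists s => //.
  by move: ps; apply: sub_path => a b /and3P[_ wb ab]; rewrite /open_step wb ab.
move=> /escapes_split[d]; rewrite mem_filter => /andP[_]; rewrite mem_filter => /andP[_ dD].
(* The first explored set contains [V x]; discarding only [V x] enlarges the event and gives the
   form required by [prob_escapes_eq0]. *)
move=> /(@escapes_mono _ _ (V x)) h; exists (pickle (x, d)) => //.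
rewrite /F pickleK dD; apply: h => z.
by rewrite /V /explored => /orP[] ->; rewrite ?orbT.
Qed.

End extinction.

Theorem mainTheorem7 (R : realType) : 2522 / 10000 < site_pc R.
Proof.
have lt : (2522 / 10000 : R) < 253 / 1000 by lra.
(* It suffices that 253/1000 lies in the set defining [site_pc], which is bounded above by 1. *)
apply: (lt_le_trans lt); apply: ub_le_sup.
  by exists 1 => p [/andP[]].
have [p0 p1] : (0 : R) <= 253 / 1000 /\ (253 / 1000 : R) <= 1 by split; lra.
have [r0 r1] : (0 : R) <= 999 / 1000 /\ (999 / 1000 : R) < 1 by split; lra.
split=> [|P perc]; first by rewrite p0.
exact: (no_infinite_component _ _ _ _ perc p0 p1 r0 r1 (@expected_weight R)).
Qed.
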